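(* Let $n\ge 3$ be an integer and let $K=\{123,132\}\{231,312\}$. The number of equivalence classes of $S_n$ under $K$-equivalence is $3\cdot 2^{n-3}+n-2$.
   Context: Permutations in $S_n$ are written as words $\pi_1\pi_2\cdots\pi_n$ in one-line notation. The order permutation of a word $u$ of $c$ distinct positive integers is the unique $\sigma\in S_c$ with $\sigma_i<\sigma_j$ iff $u_i<u_j$. A replacement partition $K$ of $S_c$ is a set partition of $S_c$; it is denoted by listing its parts with the one-element parts (and outer brackets) omitted, so here $K$ is the set partition of $S_3$ whose only parts of size greater than one are $\{123,132\}$ and $\{231,312\}$. The $K$-equivalence on $S_n$ is the equivalence relation generated by: $\phi\equiv\psi$ whenever $\phi=aub$ and $\psi=avb$ (concatenations) for some possibly empty words $a,b$ and words $u,v$ of length $c$ (so $u,v$ occupy the same $c$ consecutive positions) such that the order permutations of $u$ and $v$ lie in the same part of $K$. All equivalence classes are counted, including one-element classes. *)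

(* Defs.v *)
From mathcomp Require Import all_boot all_fingroup.
From mathcomp Require Import boolp.
From Stdlib Require Import Relation_Operators.

Set Implicit Arguments.
Unset Strict Implicit.
Unset Printing Implicit Defensive.

(* Letters are 1, ..., n, whereas 'I_n starts at 0. *)
Definition one_line n (s : 'S_n) : seq nat :=
  [seq (val (s i)).+1 | i <- enum 'I_n].

(* The clause on [i, j] determines [s]: see [order_perm_uniq]. *)
Definition is_order_perm c (u : seq nat) (s : 'S_c) : Prop :=
  size u = c /\ forall i j : 'I_c, (s i < s j) = (nth 0 u i < nth 0 u j).

(* A set partition of 'S_c given by its listed parts, each one a list of words
   in one-line notation; the omitted one-element parts are put back. *)
Definition listed_parts c (L : seq (seq (seq nat))) : {set {set 'S_c}} :=
  [set:: [seq [set s : 'S_c | one_line s \in p] | p <- L]].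

Definition replacement_partition c (L : seq (seq (seq nat))) :
    {set {set 'S_c}} :=
  listed_parts c L :|: [set [set s] | s in ~: cover (listed_parts c L)].

Definition K_step c (K : {set {set 'S_c}}) n (phi psi : 'S_n) : Prop :=
  exists a u v b : seq nat,
    [/\ one_line phi = a ++ u ++ b,
        one_line psi = a ++ v ++ b &
        exists2 P : {set 'S_c}, P \in K &
          exists s t : 'S_c,
            [/\ is_order_perm u s, is_order_perm v t, s \in P & t \in P]].

Definition K_equiv c (K : {set {set 'S_c}}) n : 'S_n -> 'S_n -> Prop :=
  clos_refl_sym_trans 'S_n (@K_step c K n).

Definition K_classes c (K : {set {set 'S_c}}) n : {set {set 'S_n}} :=
  equivalence_partition (fun phi psi : 'S_n => `[< K_equiv K phi psi >])
    [set: 'S_n].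

Definition K_123_132__231_312 : {set {set 'S_3}} :=
  replacement_partition 3
    [:: [:: [:: 1; 2; 3]; [:: 1; 3; 2]];
        [:: [:: 2; 3; 1]; [:: 3; 1; 2]]].

Lemma order_perm_uniq c (u : seq nat) (s t : 'S_c) :
  is_order_perm u s -> is_order_perm u t -> s = t.
Proof.
move=> [_ hs] [_ ht].
have rank (r : 'S_c) i : \sum_(j < c) (r j < r i) = r i.
  rewrite (reindex_inj (@perm_inj _ r^-1)) /=.
  under eq_bigr do rewrite permKV.
  rewrite -big_mkcond /= sum1_card -[RHS]card_ord.
  have le_ric : r i <= c by apply: ltnW.
  have wI : injective (widen_ord le_ric) by move=> x y [] /val_inj.
  rewrite -(card_imset _ wI).
  apply: eq_card => j; apply/idP/imsetP => [jlt|[k _ ->]]; last first.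
    by rewrite unfold_in; apply: (ltn_ord k).
  by exists (Ordinal jlt) => //; apply: val_inj.
apply/permP => i; apply: val_inj; rewrite /= -(rank s i) -(rank t i).
by apply: eq_bigr => j _; rewrite hs ht.
Qed.

Lemma one_line_inj n : injective (@one_line n).
Proof.
move=> s t /eq_in_map h; apply/permP => i; apply: val_inj.
by apply: succn_inj; apply: h; rewrite mem_enum.
Qed.

Lemma one_line_surj n (w : seq nat) :
  perm_eq w (iota 1 n) -> exists s : 'S_n, one_line s = w.
Proof.
move=> pw; have sw : size w = n by rewrite (perm_size pw) size_iota.
have uw : uniq w by rewrite (perm_uniq pw) iota_uniq.
have wP (i : 'I_n) : 0 < nth 0 w i <= n.
  have : nth 0 w i \in w by rewrite mem_nth // sw.
  by rewrite (perm_mem pw) mem_iota add1n ltnS.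
have fP (i : 'I_n) : (nth 0 w i).-1 < n.
  by have /andP[w0 wn] := wP i; rewrite prednK.
have fI : injective (fun i : 'I_n => Ordinal (fP i)).
  move=> i j [] e; apply: val_inj; apply/eqP.
  have /andP[wi _] := wP i; have /andP[wj _] := wP j.
  by rewrite -(nth_uniq 0 _ _ uw) ?sw //= -(prednK wi) -(prednK wj) e.
exists (perm fI); apply: (@eq_from_nth _ 0).
  by rewrite size_map size_enum_ord sw.
move=> k; rewrite size_map size_enum_ord => kn.
rewrite (nth_map (Ordinal kn)) ?size_enum_ord // permE /=.
by rewrite nth_enum_ord // prednK //; have /andP[] := wP (Ordinal kn).
Qed.

Lemma K_123_132__231_312_partition :
  partition K_123_132__231_312 [set: 'S_3].
Proof.
set L := listed_parts 3 [:: [:: [:: 1; 2; 3]; [:: 1; 3; 2]];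
                            [:: [:: 2; 3; 1]; [:: 3; 1; 2]]].
have tL : {in L &, forall A B : {set 'S_3}, forall x,
    x \in A -> x \in B -> A = B}.
  move=> A B; rewrite !inE => /orP[] /eqP-> /orP[] /eqP-> x //;
    by rewrite !inE => /orP[] /eqP->.
have nL : set0 \notin L.
  apply/negP; rewrite !inE => /orP[] /eqP/setP h.
    have [s e] : exists s : 'S_3, one_line s = [:: 1; 2; 3].
      exact: one_line_surj.
    by have := h s; rewrite !inE e.
  have [s e] : exists s : 'S_3, one_line s = [:: 2; 3; 1].
    exact: one_line_surj.
  by have := h s; rewrite !inE e.
have mK A : (A \in K_123_132__231_312) =
    (A \in L) || (A \in [set [set s] | s in ~: cover L]) by rewrite in_setU.
apply/and3P; split.
- rewrite eqEsubset subsetT /=; apply/subsetP => s _; apply/bigcupP.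
  have [/bigcupP[A AL sA]|sL] := boolP (s \in cover L).
    by exists A => //; rewrite mK AL.
  exists [set s]; last exact: set11.
  by rewrite mK orbC imset_f // inE.
- apply/trivIsetP => A B hA hB; apply: contraR; rewrite -setI_eq0.
  case/set0Pn=> x /setIP[xA xB]; apply/eqP; move: hA hB; rewrite !mK.
  have out C y : C \in L -> x \in C -> y \in ~: cover L -> x != y.
    move=> CL xC; rewrite inE => yL; apply: contraNneq yL => <-.
    by apply/bigcupP; exists C.
  case/orP=> [AL|/imsetP[y yL eA]] /orP[BL|/imsetP[z zL eB]].
  + exact: tL AL BL _ xA xB.
  + move: xB; rewrite eB => /set1P xz.
    by have := out _ _ AL xA zL; rewrite xz eqxx.
  + move: xA; rewrite eA => /set1P xy.
    by have := out _ _ BL xB yL; rewrite xy eqxx.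
  by move: xA xB; rewrite eA eB => /set1P-> /set1P->.
- rewrite mK negb_or nL; apply/imsetP => -[s _ e].
  by have := set11 s; rewrite -e inE.
Qed.

(* Main.v *)
Require Import Defs.
From mathcomp Require Import all_boot all_fingroup.
From mathcomp Require Import boolp zify.
From Stdlib Require Import Relation_Operators.

Set Implicit Arguments.
Unset Strict Implicit.
Unset Printing Implicit Defensive.

(** Write a permutation word as [u 1 v]. Three facts reduce it to a normal form.
    The letters of [v] may be rearranged at will ([free_after]), because each
    smallest letter frees the letters after it. If [u] is not decreasing, one
    of its letters can be moved to the right of 1 ([drop_ascent]). If [u] is
    decreasing, has at least two letters and ends with [y > 3], then 2 and 3 lie
    in [v] and [y] can be moved to the right of 1 ([drop_last]). Hence every
    class contains a word [c 1 v] with [v] increasing, where the code [c] is a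
    decreasing word on 2, ..., n that has at most one letter or ends with 2
    or 3 ([weq_code_word]).

    Different codes give different classes. If [c] ends with 2, the part [c 1]
    can never change ([step_dec2]). If [c] ends with 3, the whole class is small
    enough to be listed ([orbit3]), and [c] is the only decreasing prefix that
    occurs in it ([orbit3_dec_inj]). Finally the largest letter before 1 never
    changes ([max_before_one_step]), which separates the codes of length at most
    one ([code_word_inj]).

    There are 2^(n-2) codes ending with 2, 2^(n-3) codes ending with 3, n-3
    one-letter codes greater than 3, and the empty code: 3 * 2^(n-3) + n - 2
    in all. *)

(** * Moves on words *)

(** One elementary move on words: inside a window of three consecutive letters,
    either the two letters following the smallest one are exchanged (patterns
    123 and 132), or 231 and 312 are interchanged. The position of the window
    is given by the number of uses of [StepCons]. *)
Inductive step : seq nat -> seq nat -> Prop :=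
  | StepSwap x y z w : x < y -> x < z -> step [:: x, y, z & w] [:: x, z, y & w]
  | StepRot x y z w : x < y < z -> step [:: y, z, x & w] [:: z, x, y & w]
  | StepRotV x y z w : x < y < z -> step [:: z, x, y & w] [:: y, z, x & w]
  | StepCons c w w' : step w w' -> step (c :: w) (c :: w').

(** The equivalence generated by [step] on words. *)
Definition weq := clos_refl_sym_trans (seq nat) step.

Lemma weq_refl w : weq w w. Proof. exact: rst_refl. Qed.
Lemma weq_sym w w' : weq w w' -> weq w' w. Proof. exact: rst_sym. Qed.
Lemma weq_trans w2 w1 w3 : weq w1 w2 -> weq w2 w3 -> weq w1 w3.
Proof. exact: rst_trans. Qed.

Lemma step_perm w w' : step w w' -> perm_eq w w'.
Proof.
elim=> {w w'} [x y z w _ _|x y z w _|x y z w _|c w w' _ IH];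
  by rewrite ?perm_cons //; apply/seq.permP => p /=; lia.
Qed.

Lemma step_catl p w w' : step w w' -> step (p ++ w) (p ++ w').
Proof. by move=> h; elim: p => //= c p; apply: StepCons. Qed.

Lemma step_catr b w w' : step w w' -> step (w ++ b) (w' ++ b).
Proof.
elim=> {w w'} [x y z w h1 h2|x y z w h|x y z w h|c w w' _ IH] /=.
- exact: StepSwap.
- exact: StepRot.
- exact: StepRotV.
- exact: StepCons.
Qed.

(** In [StepSwap] the letters [y] and [z] may coincide, in which case the move is
    trivial; this is the last alternative. *)
Lemma step_window w w' : step w w' -> exists a u v b,
  [/\ w = a ++ u ++ b, w' = a ++ v ++ b &
     exists x y z, (x < y < z) /\
       ((u \in [:: [:: x; y; z]; [:: x; z; y]]) &&
        (v \in [:: [:: x; y; z]; [:: x; z; y]])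
        \/ (u \in [:: [:: y; z; x]; [:: z; x; y]]) &&
        (v \in [:: [:: y; z; x]; [:: z; x; y]]) \/ u = v)].
Proof.
elim=> {w w'} [x y z w h1 h2|x y z w h|x y z w h|c w w' _ IH] /=.
- exists [::], [:: x; y; z], [:: x; z; y], w; split=> //.
  have [yz|zy|e] := ltngtP y z.
  + by exists x, y, z; rewrite h1 yz; split=> //; left; rewrite !inE !eqxx ?orbT.
  + by exists x, z, y; rewrite h2 zy; split=> //; left; rewrite !inE !eqxx ?orbT.
  + by exists 0, 1, 2; split=> //; right; right; rewrite e.
- exists [::], [:: y; z; x], [:: z; x; y], w; split=> //.
  by exists x, y, z; split=> //; right; left; rewrite !inE !eqxx ?orbT.
- exists [::], [:: z; x; y], [:: y; z; x], w; split=> //.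
  by exists x, y, z; split=> //; right; left; rewrite !inE !eqxx ?orbT.
- by case: IH => a [u [v [b [-> -> H]]]]; exists (c :: a), u, v, b.
Qed.

Lemma weq_mono (f : seq nat -> seq nat) :
  (forall w w', step w w' -> step (f w) (f w')) ->
  forall w w', weq w w' -> weq (f w) (f w').
Proof.
move=> hf w w'; elim=> [x y h|x|x y _|x y z _ IH1 _ IH2].
- by apply: rst_step; apply: hf.
- exact: weq_refl.
- exact: weq_sym.
- exact: weq_trans IH1 IH2.
Qed.

Lemma weq_catl p w w' : weq w w' -> weq (p ++ w) (p ++ w').
Proof. apply: (weq_mono (f := cat p)); exact: step_catl. Qed.

Lemma weq_catr b w w' : weq w w' -> weq (w ++ b) (w' ++ b).
Proof. apply: (weq_mono (f := cat^~ b)); exact: step_catr. Qed.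

Lemma weq_perm w w' : weq w w' -> perm_eq w w'.
Proof.
elim=> [x y|x|x y _|x y z _ IH1 _ IH2] //; first exact: step_perm.
  by rewrite perm_sym.
exact: perm_trans IH1 IH2.
Qed.

Lemma step_sym w w' : step w w' -> step w' w.
Proof.
elim=> {w w'} [x y z w h1 h2|x y z w h|x y z w h|c w w' _ IH] /=.
- exact: StepSwap.
- exact: StepRotV.
- exact: StepRot.
- exact: StepCons.
Qed.

Lemma weq_closed (Q : seq nat -> Prop) :
  (forall w w', step w w' -> Q w -> Q w') ->
  forall w w', weq w w' -> Q w -> Q w'.
Proof.
move=> Qs w w' h; suff [] : Q w <-> Q w' by [].
elim: h => [x y st|x|x y _ IH|x y z _ IH1 _ IH2] //.
- by split; apply: Qs => //; apply: step_sym.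
- exact: iff_sym.
- exact: iff_trans IH1 IH2.
Qed.

(** * From permutations to words *)

Lemma one_line_perm n (s : 'S_n) : perm_eq (one_line s) (iota 1 n).
Proof.
apply: uniq_perm; rewrite ?iota_uniq //.
  rewrite map_inj_uniq ?enum_uniq // => i j [] /val_inj; exact: perm_inj.
move=> k; rewrite mem_iota add1n ltnS; apply/mapP/andP => [[i _ ->]|[k0 kn]].
  by split=> //; apply: ltn_ord.
have h : k.-1 < n by rewrite prednK.
exists ((s^-1)%g (Ordinal h)); first by rewrite mem_enum.
by rewrite permKV /= prednK.
Qed.

Lemma order_permP (u : seq nat) (s : 'S_3) :
  is_order_perm u s <->
  size u = 3 /\ forall i j : 'I_3,
    (nth 0 (one_line s) i < nth 0 (one_line s) j) = (nth 0 u i < nth 0 u j).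
Proof.
have E (i : 'I_3) : nth 0 (one_line s) i = (s i).+1.
  by rewrite (nth_map i) ?size_enum_ord // nth_ord_enum.
by split=> -[h1 h2]; split=> // i j; have := h2 i j; rewrite !E ltnS.
Qed.

(** The order permutation of a word of length three, spelled out through the
    six comparisons of its letters. *)
Lemma order_perm_word (u w : seq nat) (s : 'S_3) : one_line s = w ->
  is_order_perm u s <->
  exists x y z, u = [:: x; y; z] /\ 
   [/\ (x < y) = (nth 0 w 0 < nth 0 w 1), (x < z) = (nth 0 w 0 < nth 0 w 2),
       (y < z) = (nth 0 w 1 < nth 0 w 2), (y < x) = (nth 0 w 1 < nth 0 w 0) &
       (z < x) = (nth 0 w 2 < nth 0 w 0) /\ (z < y) = (nth 0 w 2 < nth 0 w 1)].
Proof.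
move=> e; rewrite order_permP e; split.
  case; case: u => [|x [|y [|z [|]]]] // _ h; exists x, y, z; split=> //.
  pose i0 : 'I_3 := @Ordinal 3 0 isT; pose i1 : 'I_3 := @Ordinal 3 1 isT.
  pose i2 : 'I_3 := @Ordinal 3 2 isT.
  by have := (h i0 i1, h i0 i2, h i1 i2, h i1 i0, (h i2 i0, h i2 i1)) => /=
     -[[[[-> ->] ->] ->] [-> ->]].
case=> x [y [z [-> [h1 h2 h3 h4 [h5 h6]]]]]; split=> //.
by case=> [[|[|[|i]]] hi] // [[|[|[|j]]] hj] //=; rewrite ?ltnn.
Qed.

Lemma step_K_step n (phi psi : 'S_n) : step (one_line phi) (one_line psi) ->
  phi <> psi -> K_step K_123_132__231_312 phi psi.
Proof.
case/step_window=> a [u [v [b [e1 e2 [x [y [z [xyz H]]]]]]]] ne.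
exists a, u, v, b; split=> //.
have K_listed p : p \in [:: [:: [:: 1; 2; 3]; [:: 1; 3; 2]];
    [:: [:: 2; 3; 1]; [:: 3; 1; 2]]] ->
  [set s : 'S_3 | one_line s \in p] \in K_123_132__231_312.
  by move=> hp; rewrite /K_123_132__231_312 inE inE map_f.
have [s1 E1] : exists s : 'S_3, one_line s = [:: 1; 2; 3].
  exact: one_line_surj.
have [s2 E2] : exists s : 'S_3, one_line s = [:: 1; 3; 2].
  exact: one_line_surj.
have [s3 E3] : exists s : 'S_3, one_line s = [:: 2; 3; 1].
  exact: one_line_surj.
have [s4 E4] : exists s : 'S_3, one_line s = [:: 3; 1; 2].
  exact: one_line_surj.
case: H => [|[|euv]]; last first.
  by case: ne; apply: one_line_inj; rewrite e1 e2 euv.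
- have P3 : is_order_perm [:: y; z; x] s3.
    by apply/(order_perm_word _ E3); exists y, z, x; split=> //=; repeat split; lia.
  have P4 : is_order_perm [:: z; x; y] s4.
    by apply/(order_perm_word _ E4); exists z, x, y; split=> //=; repeat split; lia.
  rewrite !inE => /andP[hu hv].
  exists [set s : 'S_3 | one_line s \in [:: [:: 2; 3; 1]; [:: 3; 1; 2]]].
    by apply: K_listed; rewrite !inE eqxx ?orbT.
  by case/orP: hu => /eqP ->; case/orP: hv => /eqP ->;
    [exists s3, s3 | exists s3, s4 | exists s4, s3 | exists s4, s4];
    split=> //; rewrite !inE ?E3 ?E4 ?eqxx ?orbT.
- have P1 : is_order_perm [:: x; y; z] s1.
    by apply/(order_perm_word _ E1); exists x, y, z; split=> //=; repeat split; lia.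
  have P2 : is_order_perm [:: x; z; y] s2.
    by apply/(order_perm_word _ E2); exists x, z, y; split=> //=; repeat split; lia.
  rewrite !inE => /andP[hu hv].
  exists [set s : 'S_3 | one_line s \in [:: [:: 1; 2; 3]; [:: 1; 3; 2]]].
    by apply: K_listed; rewrite !inE eqxx ?orbT.
  by case/orP: hu => /eqP ->; case/orP: hv => /eqP ->;
    [exists s1, s1 | exists s1, s2 | exists s2, s1 | exists s2, s2];
    split=> //; rewrite !inE ?E1 ?E2 ?eqxx ?orbT.
Qed.

Lemma perm_triple (x y z x' y' z' : nat) :
  perm_eq [:: x; y; z] [:: x'; y'; z'] ->
  [/\ [|| x == x', x == y' | x == z'], [|| y == x', y == y' | y == z'] &
      [|| z == x', z == y' | z == z']].
Proof.
move/perm_mem=> h.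
have := (h x, h y, h z); rewrite !inE !eqxx ?orbT /=.
by case=> -[<- <-] <-.
Qed.

(** The hypothesis lists the pairs of patterns allowed in a window: equal ones,
    or two in the same part of the replacement partition. *)
Lemma order_perm_step (u v wu wv : seq nat) (s t : 'S_3) :
    perm_eq u v -> is_order_perm u s -> is_order_perm v t ->
    one_line s = wu -> one_line t = wv ->
    (wu = wv) \/ (wu, wv) \in
      [:: ([:: 1; 2; 3], [:: 1; 3; 2]); ([:: 1; 3; 2], [:: 1; 2; 3]);
          ([:: 2; 3; 1], [:: 3; 1; 2]); ([:: 3; 1; 2], [:: 2; 3; 1])] ->
  weq u v.
Proof.
move=> puv us vt es et H.
have [x [y [z [eu]]]] := (order_perm_word u es).1 us.
have [x' [y' [z' [ev]]]] := (order_perm_word v et).1 vt.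
rewrite eu ev in puv *.
case: H => [<-|].
  move=> [<- <- <- <- [<- <-]] [r1 r2 r3 r4 [r5 r6]].
  have := perm_triple puv; rewrite perm_sym in puv; have := perm_triple puv.
  move=> [/or3P c1 /or3P c2 /or3P c3] _.
  suff [-> -> ->] : [/\ x' = x, y' = y & z' = z] by exact: weq_refl.
  by case: c1 => /eqP; case: c2 => /eqP; case: c3 => /eqP; move=> e3 e2 e1;
    rewrite e1 e2 e3 in r1 r2 r3 r4 r5 r6 *; split; lia.
rewrite !inE => /or4P[] /eqP[-> ->] /=
  [r1 r2 r3 r4 [r5 r6]] [q1 q2 q3 q4 [q5 q6]];
  have := perm_triple puv; rewrite perm_sym in puv; have := perm_triple puv;
  move=> [c1 c2 c3] [d1 d2 d3].
- have [-> -> ->] : [/\ x' = x, y' = z & z' = y] by split; lia.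
  by apply: rst_step; apply: StepSwap; lia.
- have [-> -> ->] : [/\ x' = x, y' = z & z' = y] by split; lia.
  by apply: rst_step; apply: StepSwap; lia.
- have [-> -> ->] : [/\ x' = y, y' = z & z' = x] by split; lia.
  by apply: rst_step; apply: StepRot; lia.
- have [-> -> ->] : [/\ x' = z, y' = x & z' = y] by split; lia.
  by apply: rst_step; apply: StepRotV; lia.
Qed.

Lemma K_step_weq n (phi psi : 'S_n) :
  K_step K_123_132__231_312 phi psi -> weq (one_line phi) (one_line psi).
Proof.
case=> a [u [v [b [e1 e2 [P PK [s [t [us vt sP tP]]]]]]]].
rewrite e1 e2; apply: weq_catl.
have puv : perm_eq u v.
  have : perm_eq (one_line phi) (one_line psi).
    by rewrite (permPl (one_line_perm _)) perm_sym one_line_perm.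
  by rewrite e1 e2 perm_cat2l perm_cat2r.
apply: weq_catr.
apply: (order_perm_step puv us vt erefl erefl).
move: PK; rewrite inE => /orP[|/imsetP[s0 _ eP]]; last first.
  by left; move: sP tP; rewrite eP => /set1P-> /set1P->.
rewrite !inE => /orP[] /eqP eP; move: sP tP; rewrite eP inE inE inE;
  move=> /orP[] /eqP-> /[!inE] /orP[] /eqP->; rewrite ?eqxx ?orbT;
  by [left | right].
Qed.

(** Every word equivalent to a permutation word is again a permutation word, so
    that the two equivalences agree. *)
Lemma K_equivP n (phi psi : 'S_n) :
  K_equiv K_123_132__231_312 phi psi <-> weq (one_line phi) (one_line psi).
Proof.
split.
  elim=> [x y|x|x y _|x y z _ IH1 _ IH2].
  - exact: K_step_weq.
  - exact: weq_refl.
  - exact: weq_sym.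
  - exact: weq_trans IH1 IH2.
move=> h; move ew : (one_line phi) h => w; move ew' : (one_line psi) => w' h.
elim: h phi psi ew ew' => {w w'}
  [x y h|x|x y _ IH|x y z h1 IH1 _ IH2] phi psi e e'.
- have [->|ne] := pselect (phi = psi); first exact: rst_refl.
  by apply: rst_step; apply: step_K_step ne; rewrite e e'.
- rewrite (one_line_inj (etrans e (esym e'))); exact: rst_refl.
- by apply: rst_sym; apply: IH.
- have [chi ec] : exists chi : 'S_n, one_line chi = y.
    apply: one_line_surj.
    by rewrite -(permPl (weq_perm h1)) -e one_line_perm.
  by apply: (rst_trans _ _ _ chi); [apply: IH1 | apply: IH2].
Qed.

(** * Reduction to code words *)

Lemma min_mem (v : seq nat) : v != [::] -> exists2 m, m \in v & all (leq m) v.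
Proof.
move=> v0; have : perm_eq (sort leq v) v by rewrite perm_sort.
have := sort_sorted leq_total v.
case: (sort leq v) => [|m s] /= hs pv.
  by rewrite -size_eq0 -(perm_size pv) in v0.
exists m; first by rewrite -(perm_mem pv) mem_head.
rewrite -(perm_all _ pv) /= leqnn; exact: (order_path_min leq_trans).
Qed.

(** The rearrangement hypothesis allows the prefix [p] to be made to end with an
    ascent [x' < y'], and then 231 -> 312 moves [m] one place to the left. *)
Lemma move_min_front k a m (p q : seq nat) :
    (forall v v', size v <= k -> uniq v -> all (ltn a) v -> perm_eq v v' ->
       weq (a :: v) (a :: v')) ->
    size p <= k -> uniq (p ++ m :: q) -> all (ltn a) (p ++ m :: q) ->
    all (ltn m) p ->
  exists r, weq (a :: p ++ m :: q) (a :: m :: r).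
Proof.
move=> IHk; elim: {p}_.+1 {-2}p (ltnSn (size p)) q => // j IHj p pj q pk up ap mp.
case: p pj pk up ap mp => [|x [|y t]] pj pk up ap mp.
- by exists q; apply: weq_refl.
- exists (x :: q); apply: rst_step; apply: StepSwap; move: ap => /=; lia.
(* The prefix is rearranged so that it ends with an ascent. *)
have [x' [y' [pxy xy]]] : exists x' y',
    perm_eq [:: x, y & t] (t ++ [:: x'; y']) /\ x' < y'.
  have [xy|yx|e] := ltngtP x y.
  - by exists x, y; split=> //; apply/seq.permP => P; rewrite count_cat /=; lia.
  - by exists y, x; split=> //; apply/seq.permP => P; rewrite count_cat /=; lia.
  - by move: up; rewrite /= e !inE eqxx.
have h1 : weq (a :: [:: x, y & t] ++ m :: q)
    (a :: (t ++ [:: x'; y']) ++ m :: q).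
  apply: (@weq_catr (m :: q) (a :: [:: x, y & t]) (a :: t ++ [:: x'; y'])).
  apply: IHk => //.
    by move: up; rewrite cat_uniq => /andP[].
  by move: ap; rewrite all_cat => /andP[].
have h2 : weq (a :: (t ++ [:: x'; y']) ++ m :: q)
    (a :: (t ++ [:: y']) ++ m :: x' :: q).
  rewrite -!catA /=; apply: (weq_catl (a :: t)); apply: rst_step; apply: StepRot.
  have : all (ltn m) (t ++ [:: x'; y']) by rewrite -(perm_all _ pxy).
  by rewrite all_cat /= => /and4P[_ h _ _]; rewrite xy andbT.
have h12 := weq_trans h1 h2.
have P12 : perm_eq ([:: x, y & t] ++ m :: q) ((t ++ [:: y']) ++ m :: x' :: q).
  by have := weq_perm h12; rewrite perm_cons.
have [|||||r hr] := IHj (t ++ [:: y']) _ (x' :: q).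
- by move: pj; rewrite size_cat /=; lia.
- by move: pk; rewrite size_cat /=; lia.
- by rewrite -(perm_uniq P12).
- by rewrite -(perm_all _ P12).
- have : all (ltn m) (t ++ [:: x'; y']) by rewrite -(perm_all _ pxy).
  by rewrite !all_cat /= => /and4P[-> _ -> _].
by exists r; apply: weq_trans h12 hr.
Qed.

(** The letters following a letter smaller than all of them may be rearranged
    freely: the least of them is brought to the front, after which it plays the
    role of [a] for the others. *)
Lemma free_after a v v' : uniq v -> all (ltn a) v -> perm_eq v v' ->
  weq (a :: v) (a :: v').
Proof.
have [k] := ubnP (size v); elim: k a v v' => // k IHk a v v' vk uv av pv.
have [v0|v0] := eqVneq v [::].
  by move: pv; rewrite v0 perm_sym => /perm_nilP->; apply: weq_refl.
have [m mv minm] := min_mem v0.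
have front u : perm_eq v u -> exists r, weq (a :: u) (a :: m :: r).
  move=> pu; have mu : m \in u by rewrite -(perm_mem pu).
  have uu : uniq u by rewrite -(perm_uniq pu).
  have au : all (ltn a) u by rewrite -(perm_all _ pu).
  have minu : all (leq m) u by rewrite -(perm_all _ pu).
  have su : size u <= k by rewrite -(perm_size pu).
  case/splitPr: mu uu au minu su => p q uu au minu su.
  apply: (move_min_front (k := size p)) => //.
    move=> w w' wk; apply: IHk; apply: leq_ltn_trans wk _.
    by apply: leq_trans su; rewrite size_cat /= addnS ltnS leq_addr.
  move: minu; rewrite all_cat => /andP[mp _].
  apply/allP => x xp; rewrite /= ltn_neqAle (allP mp) // andbT.
  apply: contraL uu => /eqP->; rewrite cat_uniq /= negb_and negb_and.
  by rewrite negbK xp orbT.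
have [r hr] := front v (perm_refl _); have [r' hr'] := front v' pv.
apply: (weq_trans hr); apply: weq_trans (weq_sym hr').
have pr : perm_eq v (m :: r) by have := weq_perm hr; rewrite perm_cons.
have pr' : perm_eq v' (m :: r') by have := weq_perm hr'; rewrite perm_cons.
apply: (weq_catl [:: a]); apply: IHk.
- by move: vk; rewrite (perm_size pr).
- by move: uv; rewrite (perm_uniq pr) => /andP[].
- have umr : uniq (m :: r) by rewrite -(perm_uniq pr).
  move: minm; rewrite (perm_all _ pr) => /andP[_ /allP mr].
  apply/allP => x xr; rewrite /= ltn_neqAle mr // andbT.
  by apply: contraL umr => /eqP->; rewrite /= xr.
- by rewrite -(perm_cons m) -(permPl pr) -(permPr pr').
Qed.

(** If the part before 1 is not decreasing, one of its letters can be moved to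
    the right of 1: an ascent [x < y] just before 1 is removed by [x y 1] ->
    [y 1 x], and any other ascent can be pushed to the right. *)
Lemma drop_ascent u v : uniq (u ++ 1 :: v) -> all (leq 1) u -> ~~ sorted gtn u ->
  exists u' v', size u' < size u /\ weq (u ++ 1 :: v) (u' ++ 1 :: v').
Proof.
have [k] := ubnP (size u); elim: k u v => // k IHk [|c u] v //= uk uuv pu nu.
have IHcons d u1 v1 : size u1 < k ->
    perm_eq (c :: u ++ 1 :: v) (d :: u1 ++ 1 :: v1) ->
    all (leq 1) u1 -> ~~ sorted gtn u1 ->
  exists u' v', size u' < (size u1).+1 /\
    weq (d :: u1 ++ 1 :: v1) (u' ++ 1 :: v').
  move=> u1k P1 p1 n1.
  have [||||u' [v' [h1 h2]]] := IHk u1 v1 => //.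
    by move: uuv; rewrite -/(uniq (c :: u ++ 1 :: v)) (perm_uniq P1) => /andP[].
  by exists (d :: u'), v'; split=> //; apply: (weq_catl [:: d]).
have [su|nsu] := boolP (sorted gtn u); last first.
  by apply: IHcons => //; case/andP: pu.
case: u uk uuv pu nu su IHcons => [|h t] //= uk uuv pu nu su IHcons.
have ch : c < h by move: nu uuv; rewrite !inE /= su andbT !negb_or -leqNgt; lia.
case: t uk uuv pu nu su IHcons => [|d t] /= uk uuv pu nu su IHcons.
  exists [:: h], (c :: v); split=> //=; apply: rst_step; apply: StepRot.
  by move: uuv pu; rewrite !inE; lia.
(* The initial ascent is pushed to the right, so that the tail after the first
   letter is no longer decreasing. *)
have [cd|dc] : c < d \/ d < c by move: uuv; rewrite !inE; lia.
- have st : step [:: c, h, d & t ++ 1 :: v] [:: c, d, h & t ++ 1 :: v].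
    exact: StepSwap.
  have [||||u' [v' [h1 h2]]] := IHcons c [:: d, h & t] v => //.
  + exact: step_perm st.
  + by move: pu => /=; lia.
  + by move: su => /=; lia.
  by exists u', v'; split=> //; apply: weq_trans h2; apply: rst_step.
- have st : step [:: c, h, d & t ++ 1 :: v] [:: h, d, c & t ++ 1 :: v].
    by apply: StepRot; lia.
  have [||||u' [v' [h1 h2]]] := IHcons h [:: d, c & t] v => //.
  + exact: step_perm st.
  + by move: pu => /=; lia.
  + by move=> /=; lia.
  by exists u', v'; split=> //; apply: weq_trans h2; apply: rst_step.
Qed.

(** The model case is the equivalence of 54123 with 51342: two letters smaller
    than [y] are needed to the right of 1. *)
Lemma drop_last (s v : seq nat) z y : y < z -> 3 < y -> uniq v -> all (ltn 1) v ->
    2 \in v -> 3 \in v ->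
  exists v', weq (s ++ [:: z, y, 1 & v]) (s ++ [:: z, 1 & v']).
Proof.
move=> yz y3 uv av v2 v3.
have [v0 pv] : exists v0, perm_eq v [:: 2, 3 & v0].
  exists (rem 3 (rem 2 v)); rewrite (permPl (perm_to_rem v2)) perm_cons.
  by apply: perm_to_rem; rewrite mem_rem_uniq // inE /= v3.
exists (3 :: y :: 2 :: v0); apply: weq_catl.
apply: (@weq_trans [:: z, y, 1, 2, 3 & v0]).
  by apply: (weq_catl [:: z; y]); apply: free_after.
apply: (@weq_trans [:: z, 2, y, 1, 3 & v0]).
  by apply: rst_step; do 1!apply: StepCons; apply: StepRotV; lia.
apply: (@weq_trans [:: z, 2, 3, y, 1 & v0]).
  by apply: rst_step; do 2!apply: StepCons; apply: StepRotV; lia.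
apply: (@weq_trans [:: 3, z, 2, y, 1 & v0]).
  by apply: rst_step; apply: StepRotV; lia.
apply: (@weq_trans [:: 3, z, y, 1, 2 & v0]).
  by apply: rst_step; do 2!apply: StepCons; apply: StepRot; lia.
apply: (@weq_trans [:: 3, y, z, 1, 2 & v0]).
  by apply: rst_step; apply: StepSwap; lia.
apply: (@weq_trans [:: 3, z, 1, y, 2 & v0]).
  by apply: rst_step; do 1!apply: StepCons; apply: StepRot; lia.
by apply: rst_step; apply: StepRot; lia.
Qed.

(** The codes, which index the classes: decreasing words on the letters 2, ..., n
    of length at most one, or ending with 2 or 3. *)
Definition is_code n (c : seq nat) :=
  [&& sorted gtn c, all (fun x => 1 < x <= n) c &
      (size c <= 1) || (last 0 c \in [:: 2; 3])].

(** The representative attached to a code [c]: the word [c], then 1, then the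
    remaining letters in increasing order. *)
Definition code_word n (c : seq nat) :=
  c ++ 1 :: [seq x <- iota 2 n.-1 | x \notin c].

Lemma reduce_decreasing u v : uniq (u ++ 1 :: v) -> all (leq 1) (u ++ 1 :: v) ->
  exists u' v', sorted gtn u' /\ weq (u ++ 1 :: v) (u' ++ 1 :: v').
Proof.
have [k] := ubnP (size u); elim: k u v => // k IHk u v uk uuv pu.
have [su|nsu] := boolP (sorted gtn u).
  by exists u, v; split=> //; apply: weq_refl.
have [|u1 [v1 [h1 h2]]] := drop_ascent uuv _ nsu.
  by move: pu; rewrite all_cat => /andP[].
have P := weq_perm h2.
have [|||u' [v' [su' h3]]] := IHk u1 v1.
- exact: leq_trans h1 uk.
- by rewrite -(perm_uniq P).
- by rewrite -(perm_all _ P).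
by exists u', v'; split=> //; apply: weq_trans h2 h3.
Qed.

(** A decreasing word of length at least two ending with [y > 3] leaves both 2
    and 3 to the right of 1, so that [drop_last] removes [y]. *)
Lemma reduce_last n u v : 3 <= n ->
    perm_eq (u ++ 1 :: v) (iota 1 n) -> sorted gtn u ->
  exists c v', is_code n c /\ weq (u ++ 1 :: v) (c ++ 1 :: v').
Proof.
move=> n3; have [k] := ubnP (size u); elim: k u v => // k IHk u v uk P su.
have uuv : uniq (u ++ 1 :: v) by rewrite (perm_uniq P) iota_uniq.
have range x : (x \in u) || (x == 1) || (x \in v) = (1 <= x <= n).
  by rewrite -orbA -in_cons -mem_cat (perm_mem P) mem_iota add1n ltnS.
have u1 : 1 \notin u.
  by move: uuv; rewrite cat_uniq /= negb_or => /and3P[_ /andP[]].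
have v1 : 1 \notin v.
  by move: uuv; rewrite cat_uniq /= => /and3P[_ _ /andP[]].
have allu : all (fun x => 1 < x <= n) u.
  apply/allP => x xu; have := range x; rewrite xu /= => /esym/andP[x1 xn].
  by rewrite xn andbT ltn_neqAle x1 andbT; apply: contraL xu => /eqP <-.
have [cu|] := boolP (is_code n u).
  by exists u, v; split=> //; apply: weq_refl.
rewrite /is_code su allu /= negb_or -ltnNge.
case/lastP: u uk P su uuv range u1 allu => // s y uk P su uuv range u1 allu.
rewrite last_rcons.
case/lastP: s uk P su uuv range u1 allu => // s z uk P su uuv range u1 allu.
case/andP=> _ ny.
have tr : transitive gtn by move=> a b c /= h1 h2; apply: ltn_trans h2 h1.
have [yz ys] : y < z /\ forall x, x \in rcons (rcons s z) y -> y <= x.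
  move: (su); rewrite -[rcons (rcons s z) y]revK rev_sorted !rev_rcons /=.
  case/andP=> yz h.
  split=> // x; rewrite mem_rev !inE => /or3P[/eqP->//|/eqP->|]; first exact: ltnW.
  have := order_path_min ltn_trans h => /allP h' /h' /= zx.
  by apply: ltnW; apply: ltn_trans yz zx.
have y4 : 3 < y.
  move: allu; rewrite all_rcons => /andP[]; move: ny; rewrite !inE; lia.
have inv x : 1 < x <= 3 -> x \in v.
  move=> /andP[x1 x3]; have := range x; rewrite (ltnW x1) (leq_trans x3 n3) /=.
  have -> /= : x \in rcons (rcons s z) y = false.
    by apply/negP => /ys; lia.
  by case: eqP => // e; lia.
have [||||v' hv'] := @drop_last s v z y yz y4.
- by move: uuv; rewrite cat_uniq /= => /and3P[_ _ /andP[]].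
- apply/allP => x xv /=; have := range x; rewrite xv orbT => /esym /andP[x1 _].
  by rewrite ltn_neqAle x1 andbT; apply: contraL xv => /eqP <-.
- exact: inv.
- exact: inv.
have E : rcons (rcons s z) y ++ 1 :: v = s ++ [:: z, y, 1 & v].
  by rewrite !cat_rcons.
have E' : s ++ [:: z, 1 & v'] = rcons s z ++ 1 :: v' by rewrite cat_rcons.
rewrite E in P *; rewrite E' in hv'.
have [|||c [v2 [hc h2]]] := IHk (rcons s z) v'.
- by move: uk; rewrite !size_rcons.
- by rewrite -(permPl (weq_perm hv')).
- by move: su; rewrite -[rcons (rcons s z) y]cats1 => /cat_sorted2[].
by exists c, v2; split=> //; apply: weq_trans hv' h2.
Qed.

Lemma weq_code_word n w : 3 <= n -> perm_eq w (iota 1 n) ->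
  exists2 c, is_code n c & weq w (code_word n c).
Proof.
move=> n3 P.
have w1 : 1 \in w by rewrite (perm_mem P) mem_iota; lia.
case/splitPr: w1 P => u v P.
have uuv : uniq (u ++ 1 :: v) by rewrite (perm_uniq P) iota_uniq.
have [|u1 [v1 [su1 h1]]] := reduce_decreasing uuv.
  by rewrite (perm_all _ P); apply/allP => x; rewrite mem_iota => /andP[].
have P1 : perm_eq (u1 ++ 1 :: v1) (iota 1 n) by rewrite -(permPl (weq_perm h1)).
have [c [v2 [hc h2]]] := reduce_last n3 P1 su1.
have P2 : perm_eq (c ++ 1 :: v2) (iota 1 n) by rewrite -(permPl (weq_perm h2)).
exists c => //; apply: weq_trans h1 _; apply: weq_trans h2 _.
have u2 : uniq (c ++ 1 :: v2) by rewrite (perm_uniq P2) iota_uniq.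
apply: weq_catl; apply: free_after.
- by move: u2; rewrite cat_uniq => /and3P[_ _ /andP[]].
- apply/allP => x xv; have /= := perm_mem P2 x.
  rewrite mem_cat inE xv !orbT mem_iota => /esym/andP[x1 _].
  rewrite ltn_neqAle x1 andbT; apply: contraL xv => /eqP <-.
  by move: u2; rewrite cat_uniq => /and3P[_ _ /andP[]].
apply: uniq_perm; rewrite ?filter_uniq ?iota_uniq //.
  by move: u2; rewrite cat_uniq => /and3P[_ _ /andP[]].
move=> x; rewrite mem_filter mem_iota.
have := perm_mem P2 x; rewrite mem_cat inE mem_iota.
move: u2; rewrite cat_uniq /= negb_or.
case/and3P=> _ /andP[c1 /hasPn hv] /andP[v21 _].
have [xv|xv] := boolP (x \in v2).
  have := hv x xv => /= /negPf->.
  rewrite orbT /= => /esym; have : x != 1 by apply: contraL xv => /eqP->.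
  by lia.
rewrite orbF; case: (x \in c) => //=; lia.
Qed.

(** * Invariants *)

(** The largest letter preceding the first 1, and 0 if there is none; in a word
    without 1, all letters count. *)
Fixpoint max_before_one (w : seq nat) :=
  if w is h :: t then if h == 1 then 0 else maxn h (max_before_one t) else 0.

Lemma max_before_one_step w w' : step w w' -> all (leq 1) w ->
  max_before_one w = max_before_one w'.
Proof.
elim=> {w w'} [x y z w h1 h2|x y z w h|x y z w h|c w w' _ IH] /= pw.
- by case: eqP => // _; case: eqP; case: eqP; lia.
- by case: eqP => [|_]; [lia|]; case: eqP => [|_]; [lia|]; case: eqP; lia.
- by case: eqP => [|_]; [lia|]; case: eqP => [|_]; case: eqP; lia.
- by rewrite IH //; case/andP: pw.
Qed.

Lemma max_before_one_dec c v : sorted gtn c -> all (ltn 1) c ->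
  max_before_one (c ++ 1 :: v) = head 0 c.
Proof.
elim: c => //= x c IH hs /andP[x1 hc]; case: eqP => [|_]; first by lia.
rewrite IH ?(path_sorted hs) //; apply/maxn_idPl.
by case: c hs {IH hc} => //= y c /andP[/ltnW].
Qed.

Lemma step_consP c w w' : step (c :: w) w' ->
  (exists2 w0, w' = c :: w0 & step w w0) \/
  exists y z t, w = [:: y, z & t] /\
    [\/ c < y /\ c < z /\ w' = [:: c, z, y & t],
        z < c < y /\ w' = [:: y, z, c & t] |
        y < z < c /\ w' = [:: z, c, y & t]].
Proof.
move=> st; inversion st; subst; last by left; exists w'0.
- by right; exists y, z, w0; split=> //; constructor 1.
- by right; exists z, x, w0; split=> //; constructor 2.
- by right; exists x, y, w0; split=> //; constructor 3.
Qed.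

Lemma step_after_one v w : all (ltn 1) v -> step (1 :: v) w ->
  exists2 v', w = 1 :: v' & perm_eq v v'.
Proof.
move=> av st; have := step_perm st.
case: (step_consP st) => [[w0 -> _]|[y [z [t [ev H]]]]].
  by rewrite perm_cons; exists w0.
rewrite ev /= in av; case: H => [[_ [_ ->]]|[]|[]]; try lia.
by rewrite perm_cons ev; exists [:: z, y & t].
Qed.

(** If the part before 1 decreases to 2, no move can touch it. *)
Lemma step_dec2 c v w : sorted gtn c -> last 0 c = 2 -> all (ltn 1) v ->
  step (c ++ 1 :: v) w -> exists2 v', w = c ++ 1 :: v' & perm_eq v v'.
Proof.
elim: c w => // d c IH w /= hs hl av st.
case: (step_consP st) => [[w0 -> h]|[y [z [t [e H]]]]].
  case: c hs hl h IH {st} => [|d1 c] hs hl h IH.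
    by have [v' -> ?] := step_after_one av h; exists v'.
  by have [v' -> ?] := IH w0 (path_sorted hs) hl av h; exists v'.
exfalso; case: c e hs hl {st IH} => [|d1 [|d2 c]] /= [] *; subst;
  move: av => /=; case: H => [[? [? _]]|[? _]|[? _]]; lia.
Qed.

(** [orbit3 c w] describes the words [w] equivalent to a code [c] ending with 3:
    either [w] is [c] followed by 1, with 2 somewhere after it; or 2 has moved
    to just before the final 3; or 2 stands just before 1, preceded by [c] with
    two adjacent letters exchanged. The letters of [c] preceding the place where
    the change occurs are supplied by [Orbit3Cons]. *)
Inductive orbit3 : seq nat -> seq nat -> Prop :=
  | Orbit3Short v v0 : perm_eq v (2 :: v0) -> all (ltn 3) v0 ->
      orbit3 [:: 3] [:: 3, 1 & v]
  | Orbit3Two v : all (ltn 3) v -> orbit3 [:: 3] [:: 2, 3, 1 & v]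
  | Orbit3Swap d c s v : all (ltn 3) v ->
      orbit3 [:: d, c & s] [:: c, d & s ++ [:: 2, 1 & v]]
  | Orbit3Cons c s w : orbit3 s w -> orbit3 (c :: s) (c :: w).

Lemma all_ltn_trans a b v : a <= b -> all (ltn b) v -> all (ltn a) v.
Proof. by move=> ab; apply: sub_all => x /=; apply: leq_ltn_trans. Qed.


(** The exchanged pair travels along [c] one place at a time, by 312 <-> 231. *)
Lemma orbit3_step c w w' : orbit3 c w -> sorted gtn c -> last 0 c = 3 ->
  step w w' -> orbit3 c w'.
Proof.
move=> F; elim: F w' => {c w}
  [v v0 pv av|v av|d c s v av|c s w F IH] w' /= hs hl st.
- have av1 : all (ltn 1) v.
    by rewrite (perm_all _ pv) /=; apply: all_ltn_trans av.
  case: (step_consP st) => [[w0 -> h]|[y [z [t [[e ev] H]]]]].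
    have [v' -> pv'] := step_after_one av1 h.
    by apply: Orbit3Short av; rewrite -(permPl pv').
  subst; case: H => [[? [? _]]|[? _]|[h ->]]; try lia.
  have ez : z = 2 by move: av1 h => /=; lia.
  rewrite ez; apply: Orbit3Two; move: pv; rewrite ez perm_cons => pv.
  by rewrite (perm_all _ pv).
- have av1 : all (ltn 1) v by apply: all_ltn_trans av.
  case: (step_consP st) => [[w0 -> h]|[y [z [t [[ey ez ev] H]]]]]; last first.
    subst; case: H => [[? [? _]]|[? ->]|[? _]]; try lia.
    exact: (@Orbit3Short (2 :: t) t).
  case: (step_consP h) => [[w1 -> h1]|[y [z [t [[e ev] H]]]]]; last first.
    by subst; move: av => /=; case: H => [[? [? _]]|[? _]|[? _]]; lia.
  have [v' -> pv'] := step_after_one av1 h1.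
  by apply: Orbit3Two; rewrite -(perm_all _ pv').
- have av1 : all (ltn 1) v by apply: all_ltn_trans av.
  case/andP: hs => cd hs.
  case: (step_consP st) => [[w0 -> h]|[y [z [t [e H]]]]]; last first.
    case: s e hs hl {st} => [|d1 s] /= [] *; subst.
      case: H => [[? [? _]]|[? ->]|[? _]]; try lia.
      by apply: Orbit3Cons; apply: Orbit3Two.
    case: H => [[? [? _]]|[? ->]|[? _]]; try lia.
    by apply: Orbit3Cons; apply: Orbit3Swap.
  have [||||v' -> pv'] := @step_dec2 (d :: rcons s 2) v w0.
  + case: s hs hl {h st} => [|d1 s] /= hs hl; first by lia.
    by rewrite rcons_path hl; lia.
  + by rewrite /= last_rcons.
  + by [].
  + by rewrite /= cat_rcons.
  rewrite /= cat_rcons; apply: Orbit3Swap.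
  by rewrite -(perm_all _ pv').
- have sF : s != [::] by case: F.
  have hsl : last 0 s = 3 by case: s sF hl {F IH hs}.
  case: (step_consP st) => [[w0 -> h]|[y [z [t [e H]]]]].
    by apply: Orbit3Cons; apply: IH => //; apply: path_sorted hs.
  case: F hs hsl e {IH sF st hl} =>
    [v v0 pv av|v av|d c1 s1 v av|c1 s1 w1 F] /= hs hsl.
  + by case=> *; subst; case: H => [[? [? _]]|[? _]|[? _]]; lia.
  + case=> *; subst; case: H => [[? [? _]]|[? _]|[? ->]]; try lia.
    exact: (@Orbit3Swap c 3 [::]).
  + case=> *; subst; case: H => [[? [? _]]|[? _]|[? ->]]; try lia.
    by apply: (@Orbit3Swap c z (y :: s1)).
  + case: F hs hsl => [v v0 pv av|v av|d c2 s2 v av|c2 s2 w2 F] /= hs hsl;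
      by case=> *; subst; case: H => [[? [? _]]|[? _]|[? _]]; lia.
Qed.

(** A word in [orbit3 c] whose part before 1 is decreasing has exactly [c] before
    1: the two other shapes contain an ascent before 1. *)
Lemma orbit3_dec_inj c d v : orbit3 c (d ++ 1 :: v) ->
    sorted gtn c -> all (ltn 1) c ->
  sorted gtn d -> all (ltn 1) d -> c = d.
Proof.
move ew: (d ++ 1 :: v) => w F; elim: F d ew => {c w}
  [v0 v1 pv av|v0 av|a c s v0 av|c s w F IH] d ew hs hc hd ad.
- case: d ew hd ad => [|d1 [|d2 d]] /=; [by []|by case=> ->|].
  by case=> *; subst; lia.
- by case: d ew hd ad => [|d1 [|d2 d]] /= [] *; subst; lia.
- by move: hs hc => /=; case: d ew hd ad => [|d1 [|d2 d]] /= [] *; subst; lia.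
case: d ew hd ad => [|d1 d] /=; first by case=> e; move: hc => /=; lia.
case=> -> ew hd /andP[_ ad]; rewrite (IH d) //.
- exact: path_sorted hs.
- by case/andP: hc.
- exact: path_sorted hd.
Qed.

Lemma orbit3_self s v v0 : perm_eq v (2 :: v0) -> all (ltn 3) v0 ->
  orbit3 (rcons s 3) (rcons s 3 ++ 1 :: v).
Proof.
move=> pv av; elim: s => [|c s IH] /=; last exact: Orbit3Cons.
exact: Orbit3Short pv av.
Qed.

(** * Counting the codes *)

(** The list of all subsequences of [l], with multiplicity. *)
Fixpoint subs (l : seq nat) :=
  if l is x :: l' then map (cons x) (subs l') ++ subs l' else [:: [::]].

Lemma size_subs l : size (subs l) = 2 ^ size l.
Proof.
by elim: l => //= x l IH; rewrite size_cat size_map IH expnS mul2n addnn.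
Qed.

Lemma mem_subs l s : (s \in subs l) = subseq s l.
Proof.
elim: l s => [|x l IH] s /=; first by rewrite inE; case: s.
rewrite mem_cat IH; case: s => [|y s]; first by rewrite sub0seq orbT.
case: eqP => [->|ne].
  rewrite mem_map ?IH; last by move=> ? ? [].
  by apply/orP/idP => [[//|]|->]; [apply: subseq_trans; apply: subseq_cons | left].
by case: mapP => // -[z _ [/ne]].
Qed.

Lemma uniq_subs l : uniq l -> uniq (subs l).
Proof.
elim: l => //= x l IH /andP[xl ul]; rewrite cat_uniq map_inj_uniq ?IH //;
  last by move=> ? ? [].
rewrite andbT /=; apply/hasPn => s; rewrite mem_subs => sl; apply/mapP => -[z _ e].
by move: xl; rewrite (mem_subseq sl) // e mem_head.
Qed.

(** The decreasing words on the letters [lo], ..., [lo + k - 1]. *)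
Definition dec_words lo k := subs (rev (iota lo k)).

Lemma mem_dec_words lo k s :
  (s \in dec_words lo k) = sorted gtn s && all (fun x => lo <= x < lo + k) s.
Proof.
have sr : sorted gtn (rev (iota lo k)) by rewrite rev_sorted iota_ltn_sorted.
have tr : transitive gtn by move=> a b c /= h1 h2; apply: ltn_trans h2 h1.
rewrite mem_subs; apply/idP/andP => [h|[hs ha]].
  split; first exact: subseq_sorted h sr.
  by apply/allP => x /(mem_subseq h); rewrite mem_rev mem_iota.
have -> : s = [seq x <- rev (iota lo k) | x \in s].
  apply: (irr_sorted_eq tr) => //; first by move=> x /=; rewrite ltnn.
    exact: sorted_filter.
  move=> x; rewrite mem_filter mem_rev mem_iota.
  by have [xs|//] := boolP (x \in s); rewrite (allP ha _ xs).
exact: filter_subseq.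
Qed.

(** The codes on the letters 2, ..., n. The one-letter codes 2 and 3 are counted
    among the codes ending with 2 or 3. *)
Definition codes n : seq (seq nat) :=
  [::] :: [seq [:: m] | m <- iota 4 (n - 3)] ++
  [seq rcons s 2 | s <- dec_words 3 (n - 2)] ++
  [seq rcons s 3 | s <- dec_words 4 (n - 3)].

Lemma size_codes n : 3 <= n -> size (codes n) = 3 * 2 ^ (n - 3) + n - 2.
Proof.
move=> n3; rewrite /= !size_cat !size_map !size_subs !size_rev !size_iota.
have -> : n - 2 = (n - 3).+1 by lia.
rewrite expnS; lia.
Qed.

Lemma uniq_dec_words lo k : uniq (dec_words lo k).
Proof. by rewrite uniq_subs // rev_uniq iota_uniq. Qed.

Lemma sorted_gtn_rcons s a : 
  sorted gtn (rcons s a) = sorted gtn s && all (ltn a) s.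
Proof.
have tr : transitive gtn by move=> x b c /= h1 h2; apply: ltn_trans h2 h1.
case: s => //= x s; rewrite rcons_path.
have [hs|//] := boolP (path gtn x s); rewrite andTb /=.
elim: s x hs => [|y s IH] x /=; first by rewrite andbT.
by move=> /andP[xy hs]; rewrite IH //=; lia.
Qed.

Lemma mem_codes n c : 3 <= n -> (c \in codes n) = is_code n c.
Proof.
move=> n3; rewrite inE !mem_cat; apply/idP/idP.
  case/or4P => [/eqP->//|/mapP[m]|/mapP[s]|/mapP[s]].
  - by rewrite mem_iota => hm ->; rewrite /is_code /=; lia.
  - rewrite mem_dec_words => /andP[hs ha] ->.
    rewrite /is_code sorted_gtn_rcons hs all_rcons last_rcons orbT andbT /=.
    by apply/and3P; split; [|lia|]; apply: sub_all ha => x /=; lia.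
  - rewrite mem_dec_words => /andP[hs ha] ->.
    rewrite /is_code sorted_gtn_rcons hs all_rcons last_rcons orbT andbT /=.
    by apply/and3P; split; [|lia|]; apply: sub_all ha => x /=; lia.
case/and3P; case/lastP: c => [//|s y].
rewrite sorted_gtn_rcons all_rcons last_rcons size_rcons ltnS leqn0 size_eq0 !inE.
move=> /andP[hs hy] /andP[yn ha] H.
have dec lo : y.+1 = lo -> s \in dec_words lo (n.+1 - lo).
  move=> e; rewrite mem_dec_words hs /=.
  apply/allP => x xs; have /= := allP hy x xs; have /= := allP ha x xs; lia.
have [y2|y2] := eqVneq y 2.
  apply/or4P/Or43; rewrite y2; apply: map_f.
  by have := dec 3; rewrite y2 subSS; apply.
have [y3|y3] := eqVneq y 3.
  apply/or4P/Or44; rewrite y3; apply: map_f.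
  by have := dec 4; rewrite y3 subSS; apply.
have /eqP-> : s == [::] by move: H; rewrite (negPf y2) (negPf y3) !orbF.
by apply/or4P/Or42/mapP; exists y => //; rewrite mem_iota; move: (y2) (y3); lia.
Qed.

Lemma uniq_codes n : uniq (codes n).
Proof.
have r0 (s : seq nat) a : [::] <> rcons s a by case: s.
rewrite /= !cat_uniq !map_inj_uniq ?uniq_dec_words ?iota_uniq //;
  try first [by move=> ? ? /rcons_inj[] | by move=> ? ? []].
rewrite !andbT /=; apply/and3P; split.
- by rewrite !mem_cat; apply/or3P => -[] /mapP[s _] // /r0.
- apply/hasPn => x; rewrite mem_cat => /orP[] /mapP[s _ ->]; apply/mapP => -[m hm e];
    have := congr1 (last 0) e; rewrite last_rcons /= => em;
    by move: hm; rewrite -em mem_iota.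
- apply/hasPn => x /mapP[s _ ->]; apply/mapP => -[m hm e].
  by have := congr1 (last 0) e; rewrite !last_rcons.
Qed.

Lemma code_word_perm n c : 0 < n -> is_code n c -> perm_eq (code_word n c) (iota 1 n).
Proof.
move=> n0 /and3P[hs ha _].
have uc : uniq c.
  apply: sorted_uniq hs; last by move=> x; apply: ltnn.
  by move=> a b d /= h1 h2; apply: ltn_trans h2 h1.
have c1 : 1 \notin c by apply/negP => /(allP ha).
apply: uniq_perm; rewrite ?iota_uniq //.
  rewrite cat_uniq uc /= negb_or c1 mem_filter mem_iota filter_uniq ?iota_uniq //=.
  by rewrite andbF /= andbT; apply/hasPn => x; rewrite mem_filter => /andP[].
move=> x; rewrite mem_cat inE mem_filter !mem_iota.
have [xc|xc] /= := boolP (x \in c); first by have /= := allP ha x xc; lia.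
by lia.
Qed.

Lemma cat_one_inj c d v v' : all (ltn 1) c -> all (ltn 1) d ->
  c ++ 1 :: v = d ++ 1 :: v' -> c = d.
Proof.
elim: c d => [|x c IH] [|y d] //=.
- by move=> _ /andP[h _] [e]; move: h; rewrite -e.
- by move=> /andP[h _] _ [e]; move: h; rewrite e.
- by move=> /andP[_ ac] /andP[_ ad] [-> /IH->].
Qed.

(** * Independence of the codes *)

(** Distinct codes have inequivalent code words: for a code ending with 2 or 3
    its class is described above, and the remaining codes, of length at most
    one, are read off from the largest letter before 1. *)
Lemma code_word_inj n c d : is_code n c -> is_code n d -> 0 < n ->
  weq (code_word n c) (code_word n d) -> c = d.
Proof.
move=> hc hd n0 E.
have pos e : is_code n e -> all (leq 1) (code_word n e).
  move=> he; rewrite (perm_all _ (code_word_perm n0 he)).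
  by apply/allP => x; rewrite mem_iota => /andP[].
have gt1 e : is_code n e -> all (ltn 1) e.
  by case/and3P=> _ h _; apply: sub_all h => x /andP[].
have rest1 (e : seq nat) : all (ltn 1) [seq x <- iota 2 n.-1 | x \notin e].
  by apply/allP => x; rewrite mem_filter mem_iota => /and3P[].
have dec e : is_code n e -> sorted gtn e by case/and3P.
have fam e e' (Q : seq nat -> Prop) : is_code n e -> is_code n e' ->
    (forall u u', step u u' -> Q u -> Q u') ->
    (Q (code_word n e)) -> (forall v, all (ltn 1) v -> Q (e' ++ 1 :: v) -> e = e') ->
    weq (code_word n e) (code_word n e') -> e = e'.
  move=> he he' Qs Qe Qe' w; apply: Qe' (rest1 e') _; exact: (weq_closed Qs w Qe).
have two e e' : is_code n e -> is_code n e' -> last 0 e = 2 ->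
    weq (code_word n e) (code_word n e') -> e = e'.
  move=> he he' l2.
  apply: (fam _ _ (fun u => exists2 v, u = e ++ 1 :: v & all (ltn 1) v)) => //.
  - move=> u u' st [v eu av]; rewrite eu in st.
    have [v' -> pv] := step_dec2 (dec e he) l2 av st.
    by exists v' => //; rewrite -(perm_all _ pv).
  - by exists [seq x <- iota 2 n.-1 | x \notin e].
  - by move=> v _ [v' E' _]; have := cat_one_inj (gt1 e he) (gt1 e' he') (esym E').
have three e e' : is_code n e -> is_code n e' -> last 0 e = 3 ->
    weq (code_word n e) (code_word n e') -> e = e'.
  move=> he he' l3; apply: (fam _ _ (orbit3 e)) => //.
  - by move=> u u' st F; apply: orbit3_step st => //; apply: dec.
  - case/lastP: e he l3 => // s y he; rewrite last_rcons => y3.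
    rewrite y3 in he *; rewrite /code_word.
    have /and3P[hs ha _] := he.
    have e2 : 2 \notin rcons s 3.
      apply/negP; move: hs; rewrite sorted_gtn_rcons mem_rcons inE /=.
      by case/andP=> _ hs /(allP hs).
    have n3 : 3 <= n by move: ha; rewrite all_rcons => /andP[].
    have -> : n.-1 = (n - 2).+1 by lia.
    rewrite /= e2; apply: orbit3_self (perm_refl _) _.
    apply/allP => x; rewrite mem_filter mem_iota /= mem_rcons inE negb_or; lia.
  - by move=> v _ F; apply: (orbit3_dec_inj F); auto.
have [c2|c2] := eqVneq (last 0 c) 2; first exact: two.
have [c3|c3] := eqVneq (last 0 c) 3; first exact: three.
have [d2|d2] := eqVneq (last 0 d) 2.
  by symmetry; apply: two => //; apply: weq_sym.
have [d3|d3] := eqVneq (last 0 d) 3.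
  by symmetry; apply: three => //; apply: weq_sym.
have sz e : is_code n e -> last 0 e != 2 -> last 0 e != 3 -> size e <= 1.
  by case/and3P=> _ _ H h2 h3; move: H; rewrite !inE (negPf h2) (negPf h3) !orbF.
have hd0 : head 0 c = head 0 d.
  pose Q u := all (leq 1) u /\ max_before_one u = head 0 c.
  have [] : Q (code_word n d).
    apply: weq_closed E _.
      move=> u u' st [au mu]; rewrite /Q -(perm_all _ (step_perm st)) au.
      by rewrite -(max_before_one_step st).
    by split; [exact: pos | apply: max_before_one_dec; auto].
  by rewrite max_before_one_dec; auto.
have := (sz c hc c2 c3, sz d hd d2 d3, (gt1 c hc, gt1 d hd)).
case: c hd0 {E hc c2 c3} => [|x [|x' c]]; case: d {hd d2 d3} => [|y [|y' d]] //=;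
  by [move=> <- [_ []] | move=> -> [_ []] | move=> -> | move=> _ [[]]].
Qed.

Theorem proposition3p34 (n : nat) (hn : 3 <= n) :
  #|K_classes K_123_132__231_312 n| = 3 * 2 ^ (n - 3) + n - 2.
Proof.
have n0 : 0 < n by apply: leq_trans hn.
pose class c := [set psi : 'S_n | `[< weq (code_word n c) (one_line psi) >]].
have repr c : is_code n c -> exists phi : 'S_n, one_line phi = code_word n c.
  by move=> hc; apply: one_line_surj; apply: code_word_perm.
have classE (phi : 'S_n) c : weq (one_line phi) (code_word n c) ->
    [set psi in [set: 'S_n] | `[< K_equiv K_123_132__231_312 phi psi >]] = class c.
  move=> h; apply/setP => psi; rewrite !inE; apply: asbool_equiv_eq.
  rewrite K_equivP; split=> h'; first exact: weq_trans (weq_sym h) h'.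
  exact: weq_trans h h'.
have -> : #|K_classes K_123_132__231_312 n| = #|[seq class c | c <- codes n]|.
  apply: eq_card => A; apply/imsetP/mapP => [[phi _ ->]|[c]].
    have [c hc h] := weq_code_word hn (one_line_perm phi).
    by exists c; [rewrite mem_codes | apply: classE].
  rewrite mem_codes // => hc ->; have [phi e] := repr c hc.
  by exists phi => //; rewrite (classE phi c) // e; apply: weq_refl.
rewrite (card_uniqP _) ?size_map ?size_codes // map_inj_in_uniq ?uniq_codes //.
move=> c d; rewrite !mem_codes // => hc hd /setP E.
have [phi e] := repr c hc.
have := E phi; rewrite !inE e => h.
apply: (code_word_inj hc hd n0); apply: weq_sym; apply/asboolP; rewrite -h.
by apply/asboolP; apply: weq_refl.
Qed.
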